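(* Let $n>10$ and let $H$ be an $n$-vertex linear triple system with $m>100\,n^{3/2}$ edges. Then the number of copies of the (loose) pentagon $C_5$ in $H$ is at least $m^6/n^7$.
   Context: A triple system (3-graph) $H$ consists of a finite vertex set $V(H)$ and a set $E(H)$ of 3-element subsets of $V(H)$ (edges). It is linear if every pair of vertices lies in at most one edge. The loose (linear) cycle $C_k$ is the triple system with $2k$ distinct vertices $v_1,\dots,v_k,w_1,\dots,w_k$ and the $k$ edges $\{v_i,v_{i+1},w_i\}$, $i=1,\dots,k$ (indices modulo $k$). A copy of $C_5$ in $H$ is a (not necessarily induced) subgraph of $H$ isomorphic to $C_5$; copies are counted as subgraphs (unlabeled). *)

(* Defs.v *)
From mathcomp Require Import all_boot all_order all_algebra.
From mathcomp Require Import reals exp.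
Set Implicit Arguments.
Unset Strict Implicit.
Unset Printing Implicit Defensive.

(* A hypergraph on vertex set T (all of the finType) is given by its edge set
   E : {set {set T}}. *)

Definition triple_system (T : finType) (E : {set {set T}}) : Prop :=
  forall e : {set T}, e \in E -> #|e| = 3.

Definition linear_system (T : finType) (E : {set {set T}}) : Prop :=
  forall x y : T, x != y -> #|[set e in E | [set x; y] \subset e]| <= 1.

(* inl i is v_i and inr i is w_i; ordS i is i + 1 modulo k. *)
Definition loose_cycle (k : nat) : {set {set ('I_k + 'I_k)}} :=
  [set [set inl i; inl (ordS i); inr i] | i : 'I_k].

(* A subgraph of E is a pair K = (vertex set, edge set). The isomorphism is an
   injection f of the vertices of the pattern F onto the vertex set of K that
   carries the edges of F onto those of K; in particular every edge of K lies
   inside its vertex set. *)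
Definition is_copy (U T : finType) (F : {set {set U}}) (E : {set {set T}})
    (K : {set T} * {set {set T}}) : bool :=
  (K.2 \subset E) &&
  [exists f : {ffun U -> T},
    [&& injectiveb f, f @: [set: U] == K.1
      & [set f @: (e : {set U}) | e in F] == K.2]].

Definition copies (U T : finType) (F : {set {set U}}) (E : {set {set T}}) :
    {set {set T} * {set {set T}}} :=
  [set K | is_copy F E K].

(* Main.v *)
Require Import Defs.
From mathcomp Require Import all_boot all_order all_algebra.
From mathcomp Require Import reals exp.
From mathcomp Require Import zify ring.
Import Order.TTheory GRing.Theory Num.Theory.

Set Implicit Arguments.
Unset Strict Implicit.
Unset Printing Implicit Defensive.

(** Call a cherry from v to y a pair of distinct edges e, f that meet, with
    v in e only and y in f only: it is a loose path of length two from v to y.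
    By Cauchy-Schwarz on the degrees there are about 9 m^2 / n ordered pairs
    of meeting edges, hence at least about 18 m^2 / n triples (v, e, f) where
    v lies on e but not on f and e meets f ([card_meeting_pairs],
    [card_rooted_cherries]).

    The point is that the outer edge f of such a triple contains two vertices
    y, z outside e, and e, f form a cherry from v to each of them. Discard the
    triples for which v has at most t cherries to y or to z. A discarded triple
    is itself one of those few cherries, so at most n^2 t triples are lost
    ([card_poor_cherries]); with t about 10 m^2 / n^3 a positive proportion
    survives. This is where the triple system behaves unlike a bipartite
    graph: both ends of the pair y, z inside the single edge f are typically
    reached from v, which produces odd cycles.

    A surviving triple provides a vertex v and an edge f missing v which has
    two vertices y, z with more than t cherries from v ([card_rich_pairs]). A
    cherry from v to y, a cherry from z to v and the edge f between them close
    up to a pentagon as soon as non-consecutive edges are disjoint. By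
    linearity an edge meets at most three edges through a vertex outside it
    ([card_pencil_meet]), so this excludes only a bounded number of cherries
    ([card_rooted_pentagons_rich]), which is negligible because
    t is of order m^2 / n^3 > 10^4. One thus finds at least
    (2 m^2 / n) (9 m^2 / n^3)^2 cyclic sequences of pentagon edges. A pentagon
    comes from at most 5! = 120 sequences ([card_pentagons]), and the constants
    leave room for the lower-order losses ([sixth_power_bound]). *)

(** * Double counting over finite sets *)

Lemma card_fiber_le (X Y : finType) (A : {set X}) (B : {set Y}) (h : X -> Y) k :
    (forall x, x \in A -> h x \in B) ->
    (forall y, y \in B -> #|[set x in A | h x == y]| <= k) ->
  #|A| <= #|B| * k.
Proof.
move=> hAB hk; rewrite -sum1_card (partition_big h (mem B)) //=.
rewrite -sum_nat_const; apply: leq_sum => y yB.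
by rewrite sum1dep_card hk.
Qed.

Lemma card_fiber_ge (X Y : finType) (A : {set X}) (B : {set Y}) (h : X -> Y) k :
    (forall y, y \in B -> k <= #|[set x in A | h x == y]|) ->
  #|B| * k <= #|A|.
Proof.
move=> hk; pose A' := [set x in A | h x \in B].
apply: (@leq_trans #|A'|); last first.
  by apply/subset_leq_card/subsetP=> x; rewrite inE => /andP[].
rewrite -[#|A'|]sum1_card (partition_big h (mem B)) /=; last first.
  by move=> x; rewrite inE => /andP[].
rewrite -sum_nat_const; apply: leq_sum => y yB; rewrite sum1dep_card.
apply: leq_trans (hk y yB) _; apply/subset_leq_card/subsetP => x.
by rewrite !inE => /andP[-> /eqP->]; rewrite yB eqxx.
Qed.

Lemma leq_card_bigcup (I X : finType) (P : pred I) (F : I -> {set X}) :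
  #|\bigcup_(i | P i) F i| <= \sum_(i | P i) #|F i|.
Proof.
apply: (big_ind2 (fun (A : {set X}) k => #|A| <= k)) => [|A a B b hA hB|//].
  by rewrite cards0.
exact: leq_trans (leq_card_setU A B) (leq_add hA hB).
Qed.

Lemma sum_sqr_ge (I : finType) (F : I -> nat) :
  (\sum_i F i) ^ 2 <= #|I| * \sum_i F i ^ 2.
Proof.
suff : 2 * (\sum_i F i) ^ 2 <= 2 * (#|I| * \sum_i F i ^ 2) by rewrite leq_pmul2l.
have -> : 2 * (\sum_i F i) ^ 2 = \sum_i \sum_j 2 * (F i * F j).
  rewrite -mulnn big_distrl big_distrr /=; apply: eq_bigr => i _.
  by rewrite big_distrr big_distrr.
have -> : 2 * (#|I| * \sum_i F i ^ 2) = \sum_i \sum_j (F i ^ 2 + F j ^ 2).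
  under [RHS]eq_bigr => i _ do rewrite big_split /= sum_nat_const.
  by rewrite big_split /= sum_nat_const -big_distrr /= addnn -mul2n.
by apply: leq_sum => i _; apply: leq_sum => j _; apply: nat_Cauchy.
Qed.

(** * Edges of a linear triple system *)

Definition touch (T : finType) (e f : {set T}) : bool := ~~ [disjoint e & f].

Lemma touchP (T : finType) (e f : {set T}) :
  reflect (exists2 x, x \in e & x \in f) (touch e f).
Proof.
rewrite /touch -setI_eq0; apply: (iffP (set0Pn _)) => -[x].
  by case/setIP=> xe xf; exists x.
by move=> xe xf; exists x; rewrite inE xe.
Qed.

Lemma touchC (T : finType) (e f : {set T}) : touch e f = touch f e.
Proof. by rewrite /touch disjoint_sym. Qed.

Section Cherries.

Variables (T : finType) (E : {set {set T}}).
Hypotheses (hE : triple_system E) (hlin : linear_system E).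

Lemma linear_edge_eq x y e f :
    x != y -> e \in E -> f \in E -> x \in e -> y \in e -> x \in f -> y \in f ->
  e = f.
Proof.
move=> xy eE fE xe ye xf yf; apply: (card_le1_eqP (hlin xy)).
  by rewrite inE fE subUset !sub1set xf yf.
by rewrite inE eE subUset !sub1set xe ye.
Qed.

Lemma linear_point_eq x y e f :
    e != f -> e \in E -> f \in E -> x \in e -> x \in f -> y \in e -> y \in f ->
  x = y.
Proof.
move=> ef eE fE xe xf ye yf; apply/eqP; apply: contraNT ef => xy.
by apply/eqP/(linear_edge_eq xy).
Qed.

Lemma card_edgeI e f : e \in E -> f \in E -> e != f -> #|e :&: f| <= 1.
Proof.
move=> eE fE ef; apply/card_le1_eqP => x y /setIP[xe xf] /setIP[ye yf].
exact: (@linear_point_eq _ _ e f).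
Qed.

Lemma card_edgeD e f : e \in E -> f \in E -> e != f -> 2 <= #|e :\: f|.
Proof.
by move=> eE fE ef; have := card_edgeI eE fE ef; rewrite cardsD (hE eE); lia.
Qed.

(** The sets of edges that must be avoided when a cherry is completed to a
    pentagon are all of this form. *)
Definition pencil_meet (v : T) (f : {set T}) : {set {set T}} :=
  [set e in E | (v \in e) && touch e f].

(** Through v and each of the three vertices of f there is at most one edge. *)
Lemma card_pencil_meet v f : f \in E -> v \notin f -> #|pencil_meet v f| <= 3.
Proof.
move=> fE vf.
have sub : pencil_meet v f \subset
    \bigcup_(u in f) [set e in E | [set v; u] \subset e].
  apply/subsetP => e; rewrite inE => /and3P[eE ve /touchP[u ue uf]].
  by apply/bigcupP; exists u => //; rewrite inE eE subUset !sub1set ve.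
apply: leq_trans (subset_leq_card sub) _; apply: leq_trans (leq_card_bigcup _ _) _.
rewrite -(hE fE) -sum1_card; apply: leq_sum => u uf; apply: hlin.
by apply: contraNneq vf => ->.
Qed.

Definition cherries (v y : T) : {set {set T} * {set T}} :=
  [set p in setX E E |
    [&& v \in p.1, v \notin p.2, y \notin p.1, y \in p.2 & touch p.1 p.2]].

Lemma cherriesP v y p :
  reflect [/\ p.1 \in E, p.2 \in E, touch p.1 p.2 &
           [/\ v \in p.1, v \notin p.2, y \notin p.1 & y \in p.2]]
          (p \in cherries v y).
Proof.
rewrite !inE; apply: (iffP idP).
  by case/and3P => /andP[-> ->] -> /and4P[-> -> -> ->].
by case=> -> -> -> [-> -> -> ->].
Qed.

(** Either edge of a cherry determines it up to three choices: the other edge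
    passes through a given endpoint and meets the given edge, which misses
    that endpoint. *)
Lemma card_cherries_avoid v y (X Y : {set {set T}}) :
  #|cherries v y| - 3 * (#|X| + #|Y|) <=
    #|[set p in cherries v y | (p.1 \notin X) && (p.2 \notin Y)]|.
Proof.
have hX : #|[set p in cherries v y | p.1 \in X]| <= #|X| * 3.
  apply: (@card_fiber_le _ _ _ _ fst) => [p|e eX]; first by rewrite inE => /andP[].
  set S := [set _ in _ | _]; case: (set_0Vmem S) => [->|[p]]; first by rewrite cards0.
  case/setIdP => /setIdP[/cherriesP[p1 p2 p12 [vp1 vp2 yp1 yp2]] _] /eqP pe.
  rewrite -{}pe in eX S *.
  apply: leq_trans (card_pencil_meet p1 yp1).
  apply: leq_trans (leq_imset_card (pair p.1) _).
  apply/subset_leq_card/subsetP => -[a b].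
  case/setIdP => /setIdP[/cherriesP/=[aE bE ab [va vb ya yb]] _] /eqP/= ap.
  by apply/imsetP; exists b; rewrite -?ap // inE bE yb touchC.
have hY : #|[set p in cherries v y | p.2 \in Y]| <= #|Y| * 3.
  apply: (@card_fiber_le _ _ _ _ snd) => [p|e eY]; first by rewrite inE => /andP[].
  set S := [set _ in _ | _]; case: (set_0Vmem S) => [->|[p]]; first by rewrite cards0.
  case/setIdP => /setIdP[/cherriesP[p1 p2 p12 [vp1 vp2 yp1 yp2]] _] /eqP pe.
  rewrite -{}pe in eY S *.
  apply: leq_trans (card_pencil_meet p2 vp2).
  apply: leq_trans (leq_imset_card (fun a => (a, p.2)) _).
  apply/subset_leq_card/subsetP => -[a b].
  case/setIdP => /setIdP[/cherriesP/=[aE bE ab [va vb ya yb]] _] /eqP/= bp.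
  by apply/imsetP; exists a; rewrite -?bp // inE aE va.
set G := [set _ in _ | _ && _].
have sub : cherries v y \subset
    G :|: ([set p in cherries v y | p.1 \in X] :|: [set p in cherries v y | p.2 \in Y]).
  apply/subsetP => p pC; apply/setUP.
  have [pX|pX] := boolP (p.1 \in X); first by right; apply/setUP; left; apply/setIdP.
  have [pY|pY] := boolP (p.2 \in Y); first by right; apply/setUP; right; apply/setIdP.
  by left; apply/setIdP; rewrite pX pY.
rewrite leq_subLR mulnDr addnC; apply: leq_trans (subset_leq_card sub) _.
apply: leq_trans (leq_card_setU _ _) _; rewrite leq_add2l.
apply: leq_trans (leq_card_setU _ _) _.
by rewrite ![3 * _]mulnC leq_add.
Qed.

(** * Counting cherries *)

Definition degree (x : T) : nat := #|[set e in E | x \in e]|.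

Lemma sum_degree : \sum_x degree x = 3 * #|E|.
Proof.
under eq_bigr => x _ do rewrite /degree -sum1dep_card.
rewrite (exchange_big_dep (mem E)) /=; last by move=> x e _ /andP[].
rewrite mulnC -sum_nat_const; apply: eq_bigr => e eE.
by under eq_bigl => x do rewrite eE /=; rewrite sum1_card hE.
Qed.

Definition meeting_pairs : {set {set T} * {set T}} :=
  [set p in setX E E | (p.1 != p.2) && touch p.1 p.2].

(** The sum of the squared degrees is the sum of #|e :&: f| over all ordered
    pairs of edges; distinct edges contribute at most one by linearity, and
    the diagonal contributes three for each edge. *)
Lemma sum_sqr_degree : \sum_x degree x ^ 2 <= #|meeting_pairs| + 3 * #|E|.
Proof.
have -> : \sum_x degree x ^ 2 = \sum_(p in setX E E) #|p.1 :&: p.2|.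
  under [RHS]eq_bigr => p _ do rewrite -sum1_card.
  rewrite (exchange_big_dep xpredT) //=; apply: eq_bigr => x _.
  rewrite sum1dep_card -mulnn -cardsX; apply: eq_card => -[e f].
  by rewrite !inE /=; do !case: (_ \in _).
rewrite (bigID (fun p => p.1 != p.2)) /=; apply: leq_add.
  rewrite -sum1_card big_mkcond [leqRHS]big_mkcond /=; apply: leq_sum => -[e f] _.
  rewrite !inE /=; case: andP => // -[/andP[eE fE] ef].
  rewrite eE fE ef /=; case: ifPn; first by rewrite card_edgeI.
  by rewrite negbK -setI_eq0 => /eqP->; rewrite cards0.
pose A := [set p in setX E E | p.1 == p.2].
have -> : \sum_(i in setX E E | ~~ (i.1 != i.2)) #|i.1 :&: i.2| = \sum_(p in A) 3.
  apply: eq_big => [p|p]; first by rewrite [RHS]inE negbK.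
  by rewrite !inE negbK => /andP[/andP[pE _] /eqP<-]; rewrite setIid hE.
rewrite sum_nat_const mulnC leq_mul2l /=.
rewrite -(card_in_imset (f := fst) (D := A)) => [|[a b] [c d]]; last first.
  by rewrite !inE /= => /andP[_ /eqP->] /andP[_ /eqP->] ->.
apply/subset_leq_card/subsetP => e /imsetP[p].
by rewrite !inE => /andP[/andP[pE _] _] ->.
Qed.

Lemma card_meeting_pairs :
  9 * #|E| ^ 2 <= #|T| * (#|meeting_pairs| + 3 * #|E|).
Proof.
have -> : 9 * #|E| ^ 2 = (3 * #|E|) ^ 2 by rewrite expnMn.
rewrite -sum_degree; apply: leq_trans (sum_sqr_ge _) _.
by rewrite sum_degree leq_mul2l sum_sqr_degree orbT.
Qed.

(** An element (v, (e, f)) leaves the endpoint on f open: it stands for the two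
    cherries from v to the points of f outside e. *)
Definition rooted_cherries : {set T * ({set T} * {set T})} :=
  [set c | [&& c.2.1 \in E, c.2.2 \in E, c.1 \in c.2.1, c.1 \notin c.2.2 &
             touch c.2.1 c.2.2]].

Lemma card_rooted_cherries : 2 * #|meeting_pairs| <= #|rooted_cherries|.
Proof.
rewrite mulnC; apply: (@card_fiber_ge _ _ _ _ snd) => -[e f].
rewrite !inE /= => /andP[/andP[eE fE] /andP[ef ef']].
apply: leq_trans (card_edgeD eE fE ef) _.
rewrite -(card_imset (f := fun v => (v, (e, f)))); last by move=> x y [].
apply/subset_leq_card/subsetP => _ /imsetP[v /setDP[ve vf] ->].
by rewrite !inE /= eE fE ve vf ef' eqxx.
Qed.

Variable t : nat.

(** The threshold t separates the vertices y that are hard to reach from v. *)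
Definition poor_cherries : {set T * ({set T} * {set T})} :=
  [set c in rooted_cherries |
    [exists y in c.2.2 :\: c.2.1, #|cherries c.1 y| <= t]].

(** If y witnesses that (v, (e, f)) is poor, then (e, f) is one of the at most
    t cherries from v to y; there are n^2 choices for (v, y). *)
Lemma card_poor_cherries : #|poor_cherries| <= #|T| ^ 2 * t.
Proof.
pose F (vy : T * T) := pair vy.1 @: cherries vy.1 vy.2.
have sub : poor_cherries \subset
    \bigcup_(vy | #|cherries vy.1 vy.2| <= t) F vy.
  apply/subsetP => -[v [e f]]; rewrite !inE /=.
  case/andP => /and5P[eE fE ve vf ef] /exists_inP[y /setDP[yf ye] low].
  apply/bigcupP; exists (v, y) => //; apply: imset_f.
  exact/cherriesP.
apply: leq_trans (subset_leq_card sub) _; apply: leq_trans (leq_card_bigcup _ _) _.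
rewrite -mulnn -card_prod -sum_nat_const.
rewrite [leqRHS](bigID (fun vy => #|cherries vy.1 vy.2| <= t)) /=.
apply: leq_trans (leq_addr _ _); apply: leq_sum => vy low.
exact: leq_trans (leq_imset_card _ _) low.
Qed.

Definition rich_pairs : {set T * {set T}} :=
  [set w | [&& w.2 \in E, w.1 \notin w.2 &
    [exists y in w.2, exists z in w.2,
      [&& y != z, t < #|cherries w.1 y| & t < #|cherries w.1 z|]]]].

(** The two points of f outside e are both easy to reach from v when
    (v, (e, f)) is not poor, and given (v, f) there are at most three
    possibilities for e. *)
Lemma card_rich_pairs : #|rooted_cherries :\: poor_cherries| <= #|rich_pairs| * 3.
Proof.
apply: (@card_fiber_le _ _ _ _ (fun c => (c.1, c.2.2))) => [[v [e f]]|[v f]].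
  rewrite in_setD [_ \in poor_cherries]inE => /andP[].
  case cR : (_ \in rooted_cherries) => //=.
  move: cR; rewrite !inE /= => /and5P[eE fE ve vf ef] rich _; rewrite fE vf /=.
  have fe : f != e by apply: contraNneq vf => ->.
  have /card_gt1P[y [z [yD zD yz]]] := card_edgeD fE eE fe.
  rewrite negb_exists in rich; move/forallP in rich.
  have /setDP[yf _] := yD; have /setDP[zf _] := zD.
  apply/exists_inP; exists y => //; apply/exists_inP; exists z => //.
  have := rich y; have := rich z; rewrite yD zD /= -!ltnNge => -> ->.
  by rewrite yz.
rewrite inE /= => /and3P[fE vf _].
apply: leq_trans (card_pencil_meet fE vf).
apply: leq_trans (leq_imset_card (fun e => (v, (e, f))) _).
apply/subset_leq_card/subsetP => -[v' [e f']].
rewrite !inE /= => /andP[/andP[_ /and5P[eE _ ve _ ef]] /eqP[vv ff]].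
by subst; apply/imsetP; exists e => //; rewrite inE eE ve.
Qed.

End Cherries.

(** * Pentagons as cyclic sequences of edges *)

(** Five edges in cyclic order, consecutive ones meeting and the others
    disjoint. In a linear triple system these are exactly the pentagons with a
    starting edge and a direction, and the vertices need not be recorded. *)
Definition pentagons (T : finType) (E : {set {set T}}) :
    {set {ffun 'I_5 -> {set T}}} :=
  [set e : {ffun 'I_5 -> {set T}} | [forall i, [&& e i \in E,
     touch (e i) (e (ordS i)) & [disjoint e i & e (ordS (ordS i))]]]].

Lemma cyclic5_cases (i j : 'I_5) :
  i = j \/ [\/ j = ordS i, j = ordS (ordS i), i = ordS j | i = ordS (ordS j)].
Proof.
case: i j => [[|[|[|[|[|//]]]]] hi] [[|[|[|[|[|//]]]]] hj];
by [ left; apply: val_inj | right; constructor 1; apply: val_inj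
   | right; constructor 2; apply: val_inj | right; constructor 3; apply: val_inj
   | right; constructor 4; apply: val_inj].
Qed.

Section Pentagons.

Variables (T : finType) (E : {set {set T}}).
Hypotheses (hE : triple_system E) (hlin : linear_system E).

(** The vertex v_i is chosen in the intersection of the edges i - 1 and i, and
    w_i is the remaining point of edge i. All ten points differ: two of them
    that do not lie on consecutive edges lie on disjoint ones, and consecutive
    edges share only one point. *)
Lemma pentagon_copy e : e \in pentagons E ->
  injective e /\ exists2 K, K \in copies (loose_cycle 5) E & K.2 = e @: setT.
Proof.
rewrite inE => /forallP he.
have eE i : e i \in E by case/and3P: (he i).
have disj i x : x \in e i -> x \in e (ordS (ordS i)) -> False.
  by case/and3P: (he i) => _ _ /disjointFr d xi; rewrite d.
have eS i : e i != e (ordS i).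
  case/and3P: (he (ord_pred i)) => _; rewrite ord_predK => /touchP[x x1 x2] _.
  apply/eqP => eq; apply: (disj (ord_pred i) x) => //.
  by rewrite ord_predK -eq.
have injE : injective e.
  move=> i j eij; have [u ui] : exists u, u \in e i.
    by apply/set0Pn; rewrite -card_gt0 hE.
  case: (cyclic5_cases i j) => [//|[jS|jS|iS|iS]].
  - by move: (eS i); rewrite -jS eij eqxx.
  - by case: (disj i u ui); rewrite -jS -eij.
  - by move: (eS j); rewrite -iS eij eqxx.
  - by case: (disj j u); rewrite -?iS -?eij.
split=> //.
have [v hv] : exists v, forall i, v i \in e i /\ v i \in e (ord_pred i).
  apply: (@fin_all_exists _ (fun=> T)
    (fun i x => x \in e i /\ x \in e (ord_pred i))) => i.
  case/and3P: (he (ord_pred i)) => _.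
  by rewrite ord_predK => /touchP[x x1 x2] _; exists x.
have ve i : v i \in e i by case: (hv i).
have vSe i : v (ordS i) \in e i by have [_] := hv (ordS i); rewrite ordSK.
have [w hw] : exists w, forall i, [/\ w i \in e i, w i != v i & w i != v (ordS i)].
  apply: (@fin_all_exists _ (fun=> T)
    (fun i x => [/\ x \in e i, x != v i & x != v (ordS i)])) => i.
  have : 0 < #|e i :\: [set v i; v (ordS i)]|.
    have := subset_leq_card (subsetIr (e i) [set v i; v (ordS i)]).
    by rewrite cardsD (hE (eE i)) cards2; case: (_ != _) => /=; lia.
  by case/card_gt0P => x; rewrite !inE negb_or => /andP[/andP[]]; exists x.
have we i : w i \in e i by case: (hw i).
have injv : injective v.
  move=> i j vij; case: (cyclic5_cases i j) => [//|[jS|jS|iS|iS]].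
  - by case: (disj (ord_pred i) (v i) (proj2 (hv i))); rewrite ord_predK -jS vij.
  - by case: (disj i (v i) (ve i)); rewrite -jS vij.
  - by case: (disj (ord_pred j) (v j) (proj2 (hv j))); rewrite ord_predK -iS -vij.
  - by case: (disj j (v j) (ve j)); rewrite -iS -vij.
have injw : injective w.
  have wS i : w i <> w (ordS i).
    move=> eq; case: (hw i) => _ _ /eqP; apply.
    apply: (linear_point_eq hlin (eS i) (eE _) (eE _)) => //; rewrite eq; apply: we.
  move=> i j wij; case: (cyclic5_cases i j) => [//|[jS|jS|iS|iS]].
  - by case: (wS i); rewrite -jS.
  - by case: (disj i (w i) (we i)); rewrite -jS wij.
  - by case: (wS j); rewrite -iS.
  - by case: (disj j (w j) (we j)); rewrite -iS -wij.
have vw i j : v i <> w j.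
  move=> vwij; case: (cyclic5_cases i j) => [jS|[jS|jS|iS|iS]].
  - by case: (hw i) => _ /eqP + _; apply; rewrite vwij jS.
  - by apply: (disj (ord_pred i) (v i) (proj2 (hv i))); rewrite ord_predK -jS vwij.
  - by apply: (disj i (v i) (ve i)); rewrite -jS vwij.
  - by case: (hw j) => _ _ /eqP; apply; rewrite -vwij iS.
  - by apply: (disj j (w j) (we j)); rewrite -iS -vwij.
pose g : {ffun 'I_5 + 'I_5 -> T} :=
  finfun (fun u : 'I_5 + 'I_5 => match u with inl i => v i | inr i => w i end).
have ginj : injective g.
  move=> [i|i] [j|j]; rewrite !ffunE.
  - by move/injv->.
  - by move/vw.
  - by move/esym/vw.
  - by move/injw->.
have gE i : g @: [set inl i; inl (ordS i); inr i] = e i.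
  apply/eqP; rewrite eqEcard (hE (eE i)) card_imset //; apply/andP; split.
    apply/subsetP => x /imsetP[u]; rewrite !inE -orbA => /or3P[] /eqP-> ->;
    by rewrite ffunE.
  by rewrite setUC cardsU1 cards2 !inE /=; case: eqP => // -[] iS;
     move: (eS i); rewrite -iS eqxx.
exists (g @: setT, e @: setT) => //.
rewrite inE /is_copy /=; apply/andP; split.
  by apply/subsetP => _ /imsetP[i _ ->].
apply/existsP; exists g; rewrite eqxx /=; apply/andP; split; first exact/injectiveP.
apply/eqP; rewrite /loose_cycle -imset_comp.
rewrite (eq_imset _ (g := e)) //.
by apply/setP => x; apply/imsetP/imsetP => -[i _ ->]; exists i.
Qed.

(** A sequence is an injective enumeration of the five edges of its copy. *)
Lemma card_pentagons : #|pentagons E| <= 120 * #|copies (loose_cycle 5) E|.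
Proof.
pose L (K : {set T} * {set {set T}}) :=
  [set e : {ffun 'I_5 -> {set T}} | injectiveb e & e @: setT == K.2].
have sub : pentagons E \subset \bigcup_(K in copies (loose_cycle 5) E) L K.
  apply/subsetP => e /pentagon_copy[/injectiveP einj [K KC KE]].
  by apply/bigcupP; exists K; rewrite // inE einj KE eqxx.
apply: leq_trans (subset_leq_card sub) _; apply: leq_trans (leq_card_bigcup _ _) _.
rewrite mulnC -sum_nat_const; apply: leq_sum => K _.
have [->|[e0]] := set_0Vmem (L K); first by rewrite cards0.
rewrite inE => /andP[/injectiveP inj0 /eqP e0K].
have K5 : #|K.2| = 5 by rewrite -e0K card_imset // cardsT card_ord.
have := card_inj_ffuns_on 'I_5 (mem K.2).
rewrite [X in X ^_ _]K5 card_ord (_ : 5 ^_ 5 = 120) // => <-.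
apply/subset_leq_card/subsetP => e.
rewrite !inE => /andP[-> /eqP eK]; rewrite andbT.
by apply/ffun_onP => i; rewrite -eK imset_f.
Qed.

(** * Building pentagons from two cherries *)

(** The data w = ((v, f), ((e1, e2), (e5, e4))) consist of a root v, the edge f
    opposite to it, and two cherries that start at v and end on f; around the
    cycle the edges come in the order e1, e2, f, e4, e5. *)
Definition rooted_pentagon
    (w : (T * {set T}) * (({set T} * {set T}) * ({set T} * {set T}))) :
    {ffun 'I_5 -> {set T}} :=
  [ffun i : 'I_5 => nth set0 [:: w.2.1.1; w.2.1.2; w.1.2; w.2.2.2; w.2.2.1] i].

Definition rooted_pentagons :=
  [set w : (T * {set T}) * (({set T} * {set T}) * ({set T} * {set T})) |
    [&& w.1.1 \in w.2.1.1, w.1.1 \in w.2.2.1 &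
             rooted_pentagon w \in pentagons E]].

Lemma rooted_pentagonP w :
  reflect
    [/\ [/\ w.2.1.1 \in E, w.2.1.2 \in E, w.1.2 \in E, w.2.2.2 \in E & w.2.2.1 \in E],
        [/\ touch w.2.1.1 w.2.1.2, touch w.2.1.2 w.1.2, touch w.1.2 w.2.2.2,
            touch w.2.2.2 w.2.2.1 & touch w.2.2.1 w.2.1.1]
      & [/\ [disjoint w.2.1.1 & w.1.2], [disjoint w.2.1.2 & w.2.2.2],
            [disjoint w.1.2 & w.2.2.1], [disjoint w.2.2.2 & w.2.1.1]
          & [disjoint w.2.2.1 & w.2.1.2]]]
    (rooted_pentagon w \in pentagons E).
Proof.
rewrite inE; apply: (iffP forallP) => [h|].
  have h0 := h (@Ordinal 5 0 isT); have h1 := h (@Ordinal 5 1 isT).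
  have h2 := h (@Ordinal 5 2 isT); have h3 := h (@Ordinal 5 3 isT).
  have h4 := h (@Ordinal 5 4 isT); move: h0 h1 h2 h3 h4; rewrite !ffunE /=.
  by do 5 case/and3P=> ? ? ?; split; split.
case=> -[? ? ? ? ?] [? ? ? ? ?] [? ? ? ? ?] [[|[|[|[|[|//]]]]] hi];
  by rewrite !ffunE /=; apply/and3P.
Qed.

(** The root is recovered from the sequence as the only common point of its
    first and last edges. *)
Lemma card_rooted_pentagons : #|rooted_pentagons| <= #|pentagons E|.
Proof.
rewrite -(card_in_imset (f := rooted_pentagon) (D := rooted_pentagons)).
  by apply/subset_leq_card/subsetP => e /imsetP[w]; rewrite inE => /and3P[_ _ +] ->.
move=> [[v f] [[e1 e2] [e5 e4]]] [[v' f'] [[e1' e2'] [e5' e4']]].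
rewrite in_set => /and3P[/= v1 v5 pw]; rewrite in_set => /and3P[/= v1' v5' _] /ffunP eq.
have eq0 := eq (@Ordinal 5 0 isT); have eq1 := eq (@Ordinal 5 1 isT).
have eq2 := eq (@Ordinal 5 2 isT); have eq3 := eq (@Ordinal 5 3 isT).
have eq4 := eq (@Ordinal 5 4 isT); move: eq0 eq1 eq2 eq3 eq4; rewrite !ffunE /=.
move=> eq0 eq1 eq2 eq3 eq4; subst e1' e2' f' e4' e5'.
case/rooted_pentagonP: pw => /= -[e1E e2E _ _ e5E] [e12 _ _ _ _] [_ _ _ _ d52].
congr ((_, _), _); apply: (linear_point_eq hlin (e := e1) (f := e5)) => //.
by apply: contraTneq d52 => <-.
Qed.

Lemma disjoint_pencil u e f :
  e \in E -> u \in e -> e \notin pencil_meet E u f -> [disjoint e & f].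
Proof. by move=> eE ue; rewrite inE eE ue negbK. Qed.

(** Choose a cherry (e1, e2) from v to y and then a cherry (e5, e4) from v to z.
    The first has to avoid the at most 3 edges e1 through v that meet f. For
    the second, e5 must miss f and e2, and e4 must miss e1 and e2: at most
    3 + 3 edges are forbidden in either position. Each forbidden edge kills
    at most 3 cherries, which gives the losses 9 = 3 * 3 and 36 = 3 * 12. *)
Lemma card_rooted_pentagons_rich t :
  #|rich_pairs E t| * ((t - 9) * (t - 36)) <= #|rooted_pentagons|.
Proof.
apply: (@card_fiber_ge _ _ _ _ fst) => -[v f].
rewrite inE /= => /and3P[fE vf /exists_inP[y yf /exists_inP[z zf /and3P[yz ty tz]]]].
pose A := [set p in cherries E v y | (p.1 \notin pencil_meet E v f) && (p.2 \notin set0)].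
have hA : t - 9 <= #|A|.
  apply: leq_trans (card_cherries_avoid hE hlin v y _ _).
  apply: leq_sub (ltnW ty) _; rewrite cards0 addn0 (@leq_mul2l 3 _ 3).
  exact: card_pencil_meet.
set W := [set w in rooted_pentagons | _].
have hW : #|A| * (t - 36) <= #|W|.
  apply: (@card_fiber_ge _ _ _ _ (fun w => w.2.1)) => -[e1 e2].
  case/setIdP => /cherriesP[/= e1E e2E e12 [v1 v2 y1 y2]] /andP[d13 _].
  have {}d13 := disjoint_pencil e1E v1 d13.
  (* As e1 misses f and meets e2, the edges e2 and f differ; linearity then
     keeps z out of e2. *)
  have ne2f : e2 != f by apply: contraTneq d13 => <-.
  have z1 : z \notin e1 by rewrite (disjointFl d13).
  have z2 : z \notin e2.
    by apply: contra ne2f => z2; apply/eqP/(linear_edge_eq hlin yz).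
  have hB := card_cherries_avoid hE hlin v z
    (pencil_meet E v f :|: pencil_meet E v e2)
    (pencil_meet E z e1 :|: pencil_meet E z e2).
  set B := [set q in _ | _] in hB.
  apply: (@leq_trans #|B|).
    apply: leq_trans hB.
    apply: leq_sub (ltnW tz) _; rewrite (@leq_mul2l 3 _ 12) /= (@leq_add _ _ 6 6) //.
      apply: leq_trans (leq_card_setU _ _) _.
      by rewrite (@leq_add _ _ 3 3) // card_pencil_meet.
    apply: leq_trans (leq_card_setU _ _) _.
    by rewrite (@leq_add _ _ 3 3) // card_pencil_meet.
  rewrite -(card_imset (f := fun q => ((v, f), ((e1, e2), q)))); last by move=> q q' [].
  apply/subset_leq_card/subsetP => _ /imsetP[[e5 e4] qB ->].
  case/setIdP: qB => /cherriesP[/= e5E e4E e54 [v5 v4 z5 z4]].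
  rewrite !in_setU !negb_or => /andP[/andP[n5f n52] /andP[n41 n42]].
  have d5f := disjoint_pencil e5E v5 n5f; have d52 := disjoint_pencil e5E v5 n52.
  have d41 := disjoint_pencil e4E z4 n41; have d42 := disjoint_pencil e4E z4 n42.
  apply/setIdP; split; last exact: eqxx.
  apply/setIdP; split; last exact: eqxx.
  rewrite in_set /= v1 v5; apply/rooted_pentagonP; split; split=> //=.
  - by apply/touchP; exists y.
  - by apply/touchP; exists z.
  - by rewrite touchC.
  - by apply/touchP; exists v.
  - by rewrite disjoint_sym.
  - by rewrite disjoint_sym.
by apply: leq_trans hW; rewrite leq_mul2r hA orbT.
Qed.

(** The factor 360 is 3 * 5!: three inner edges for each pair (v, f), and 5!
    orderings of the edges of a pentagon. *)
Lemma count_pentagon_copies t :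
  (2 * #|meeting_pairs E| - #|T| ^ 2 * t) * ((t - 9) * (t - 36)) <=
    360 * #|copies (loose_cycle 5) E|.
Proof.
have h1 := card_rooted_cherries hE hlin.
have h2 := card_poor_cherries E t.
have h3 := card_rich_pairs hE hlin t.
have h4 := leq_trans (card_rooted_pentagons_rich t)
  (leq_trans card_rooted_pentagons card_pentagons).
have h5 : 2 * #|meeting_pairs E| - #|T| ^ 2 * t <= #|rich_pairs E t| * 3.
  apply: leq_trans h3; rewrite cardsD.
  apply: leq_sub h1 (leq_trans (subset_leq_card (subsetIr _ _)) h2).
apply: leq_trans (leq_mul h5 (leqnn _)) _.
by rewrite mulnAC; apply: leq_trans (leq_mul h4 (leqnn 3)) _; rewrite mulnAC.
Qed.

End Pentagons.

(** * The numerical bound *)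

(** The choice t = 10 m^2 / n^3 gives n (2 M - n^2 t) >= 6 m^2, while
    n^3 (t - 36) >= 9 m^2 since t is large; and 6 * 9 * 9 = 486 >= 360. *)
Lemma sixth_power_bound (n m M c : nat) :
    100 ^ 2 * n ^ 3 < m ^ 2 -> 9 * m ^ 2 <= n * (M + 3 * m) ->
    (forall t, (2 * M - n ^ 2 * t) * ((t - 9) * (t - 36)) <= 360 * c) ->
  m ^ 6 <= n ^ 7 * c.
Proof.
case: (posnP n) => [->|n0] hnm hM hc.
  have : m = 0 by lia.
  by move=> ->.
have m3n : 3 * n <= m.
  rewrite -leq_sqr; apply: leq_trans (ltnW hnm); rewrite expnMn leq_mul //.
  exact: leq_pexp2l.
pose t := (10 * m ^ 2) %/ n ^ 3.
have n30 : 0 < n ^ 3 by rewrite expn_gt0 n0.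
have tle : t * n ^ 3 <= 10 * m ^ 2 := leq_trunc_div _ _.
have tgt : 10 * m ^ 2 < t.+1 * n ^ 3 := ltn_ceil _ n30.
have t0 : 1000 <= t.
  rewrite leq_divRL //; lia.
have hA : 6 * m ^ 2 <= n * (2 * M - n ^ 2 * t).
  rewrite mulnBr [n * (n ^ 2 * t)]mulnA -expnS [n ^ 3 * t]mulnC leq_subRL.
    nia.
  nia.
have hB : 9 * m ^ 2 <= n ^ 3 * (t - 36) by nia.
have hB' : 9 * m ^ 2 <= n ^ 3 * (t - 9).
  by apply: leq_trans hB _; rewrite leq_mul2l leq_sub2l // orbT.
have h := leq_mul hA (leq_mul hB' hB).
have {}hc := hc t.
have e1 : 6 * m ^ 2 * (9 * m ^ 2 * (9 * m ^ 2)) = 486 * m ^ 6.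
  rewrite (_ : m ^ 6 = m ^ 2 * (m ^ 2 * m ^ 2)); [lia|by rewrite -!expnD].
have e2 : n * (2 * M - n ^ 2 * t) * (n ^ 3 * (t - 9) * (n ^ 3 * (t - 36))) =
   n ^ 7 * ((2 * M - n ^ 2 * t) * ((t - 9) * (t - 36))).
  rewrite (_ : n ^ 7 = n * (n ^ 3 * n ^ 3)); last by rewrite -!expnD -expnS.
  move: (2 * M - _) (t - 9) (t - 36) (n ^ 3) => a b d k; ring.
rewrite e1 e2 in h.
have := leq_trans h (leq_mul (leqnn (n ^ 7)) hc).
lia.
Qed.

Local Open Scope ring_scope.

Lemma sqr_lt_of_powR (R : realType) (n m : nat) :
  100%:R * (n%:R `^ (3%:R / 2%:R)) < m%:R :> R -> (100 ^ 2 * n ^ 3 < m ^ 2)%N.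
Proof.
move=> h; rewrite -(ltr_nat R) natrM !natrX.
have -> : 100%:R ^+ 2 * n%:R ^+ 3 = (100%:R * (n%:R `^ (3%:R / 2%:R))) ^+ 2 :> R.
  rewrite exprMn; congr (_ * _).
  rewrite -[RHS]powR_mulrn ?powR_ge0 // -powRrM divfK ?pnatr_eq0 //.
  by rewrite powR_mulrn // ler0n.
by rewrite ltrXn2r // ?mulr_ge0 ?powR_ge0 ?ler0n.
Qed.

Theorem theorem1p1 (R : realType) (n m : nat) (T : finType)
    (E : {set {set T}})
    (hn : (10 < n)%N) (hT : #|T| = n)
    (hE : triple_system E) (hlin : linear_system E)
    (hm : #|E| = m)
    (hmn : 100%:R * (n%:R `^ (3%:R / 2%:R)) < m%:R :> R) :
  m%:R ^+ 6 / n%:R ^+ 7 <= #|copies (loose_cycle 5) E|%:R :> R.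
Proof.
have n0 : (0 < n)%N by exact: leq_trans hn.
rewrite ler_pdivrMr ?exprn_gt0 ?ltr0n // -!natrX -natrM ler_nat mulnC.
apply: (@sixth_power_bound n m #|meeting_pairs E|).
- exact: sqr_lt_of_powR hmn.
- by rewrite -hm -hT card_meeting_pairs.
- by move=> t; rewrite -hT count_pentagon_copies.
Qed.
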